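(* Let $\mathcal{A}$ be a deterministic finite automaton and let $M(\mathcal{A})$ be its adjacency matrix. Then $\mathcal{A}$ is minimal if and only if both the rank and the nullity of $M(\mathcal{A})$ are minimal; that is, the following are equivalent: (i) $|\mathcal{A}| \leq |\mathcal{B}|$ for every deterministic finite automaton $\mathcal{B}$ with $L(\mathcal{B}) = L(\mathcal{A})$; (ii) $\mathrm{rank}(M(\mathcal{A})) \leq \mathrm{rank}(M(\mathcal{B}))$ and $\mathrm{null}(M(\mathcal{A})) \leq \mathrm{null}(M(\mathcal{B}))$ for every deterministic finite automaton $\mathcal{B}$ with $L(\mathcal{B}) = L(\mathcal{A})$.
   Context: A deterministic finite automaton is a quintuple $\mathcal{A} = \langle Q, A, \delta, q_0, F\rangle$ with $Q$ a finite set of states, $A$ a finite alphabet, $\delta : Q \times A \to Q$ the transition function (extended to words in the usual way), $q_0 \in Q$ the initial state, and $F \subseteq Q$ the set of final states. A word $w \in A^*$ is accepted if $\delta(q_0, w) \in F$; $L(\mathcal{A})$ is the set of accepted words. Two automata (over the same alphabet) are equivalent if their languages are identical. $|\mathcal{A}| := |Q|$ is the number of states. An automaton is minimal if it has the smallest number of states among all deterministic finite automata recognising the same language. The adjacency matrix $M(\mathcal{A})$ is the $Q \times Q$ matrix whose $(p,q)$ entry is the number of letters $a \in A$ with $\delta(p,a) = q$. $\mathrm{rank}(M)$ is the rank of $M$ and $\mathrm{null}(M)$ is the dimension of the kernel $\{\boldsymbol{v} \mid M\boldsymbol{v} = \boldsymbol{0}\}$ (over the reals). *)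

(* Defs.v *)
From mathcomp Require Import all_boot all_order all_algebra.
From mathcomp Require Import reals.
Set Implicit Arguments.
Unset Strict Implicit.
Unset Printing Implicit Defensive.
Local Open Scope ring_scope.

Record dfa (A : finType) := DFA {
  state : finType;
  trans : state -> A -> state;
  init : state;
  final : {set state}
}.
Arguments state {A} _.
Arguments trans {A} _ _ _.
Arguments init {A} _.
Arguments final {A} _.

Definition trans_word (A : finType) (D : dfa A) (q : state D) (w : seq A) :
  state D := foldl (trans D) q w.

Definition lang (A : finType) (D : dfa A) : pred (seq A) :=
  [pred w | trans_word (init D) w \in final D].

Definition dfa_equiv (A : finType) (D E : dfa A) : Prop := lang D =i lang E.

Definition dfa_size (A : finType) (D : dfa A) : nat := #|state D|.

(* The state set is enumerated by [enum_val : 'I_#|state D| -> state D], as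
   matrices are indexed by ordinals; rank and nullity do not depend on this. *)
Definition adjmx (R : realType) (A : finType) (D : dfa A) :
  'M[R]_(dfa_size D) :=
  \matrix_(i, j) #|[set a : A | trans D (enum_val i) a == enum_val j]|%:R.

(* The kernel consists of column vectors, whereas [kermx] is a left kernel. *)
Definition nullity (R : realType) (n : nat) (M : 'M[R]_n) : nat :=
  \dim (lker (linfun (mulmx M : 'cV[R]_n -> 'cV[R]_n))).

(* Main.v *)
Require Import Defs.
From mathcomp Require Import all_boot all_order all_algebra.
From mathcomp Require Import boolp reals.

(** Write [P_f] for the 0/1 matrix of a map [f]; then [P_f P_g = P_(g o f)] and
    [M(A)] is the sum of the [P_(delta(-, a))], so a morphism of automata
    [h : P -> Q] satisfies [P_h M(Q) = M(P) P_h]. If [h] is injective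
    (surjective), [P_h] has a right (left) inverse, so that [M(P)] has at most
    (at least) the rank and the nullity of [M(Q)]. When [D] is minimal, the
    reachable part of an equivalent [E] embeds in [E] and maps onto [D]. The
    converse holds because rank and nullity add up to the number of states. *)

Set Implicit Arguments.
Unset Strict Implicit.
Unset Printing Implicit Defensive.
Import GRing.Theory.

Section RankNullity.
Local Open Scope ring_scope.

(** Transposition identifies the kernel of [M] on columns with the left kernel of [M^T]; [phi]
    realises this from coordinates in a basis of the latter. *)
Lemma nullityE (R : realType) (n : nat) (M : 'M[R]_n) :
  nullity M = (n - \rank M)%N.
Proof.
set B := row_base (kermx M^T).
pose phi : 'rV[R]_(\rank (kermx M^T)) -> 'cV[R]_n := trmx \o mulmxr B.
have phi_inj : lker (linfun phi) == 0%VS.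
  apply/lker0P => u v; rewrite !lfunE /= => /trmx_inj.
  by apply: row_free_inj; exact: row_base_free.
have phi_im :
    limg (linfun phi) = lker (linfun (mulmx M : 'cV[R]_n -> 'cV[R]_n)).
  apply/vspaceP => v; rewrite memv_ker lfunE /=; apply/memv_imgP/eqP.
    case=> u _ ->; rewrite lfunE /=; apply: trmx_inj; rewrite trmx_mul trmxK trmx0.
    apply/eqP; rewrite -sub_kermx (submx_trans (submxMl _ _)) //.
    by rewrite eq_row_base.
  move=> Mv0; have /submxP[u uB] : (v^T <= B)%MS.
    by rewrite eq_row_base sub_kermx -trmx_mul Mv0 trmx0.
  by exists u; rewrite ?memvf // lfunE /= -uB trmxK.
rewrite /nullity -phi_im limg_dim_eq; last by rewrite (eqP phi_inj) capv0.
by rewrite dimvf dim_matrix mul1r mxrank_ker mxrank_tr.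
Qed.

(** The equality [M = X N Y] bounds the rank. Right multiplication by [X] is injective and sends the
    left kernel of [M] into that of [N], since [u M = 0] gives [u X N = u M X = 0]. *)
Lemma rank_nullity_row_free (F : fieldType) (m n : nat)
    (M : 'M[F]_m) (N : 'M[F]_n) (X : 'M[F]_(m, n)) (Y : 'M[F]_(n, m)) :
  X *m N = M *m X -> X *m Y = 1%:M ->
  (\rank M <= \rank N)%N /\ (m - \rank M <= n - \rank N)%N.
Proof.
move=> XN XY; split.
  rewrite -[M]mulmx1 -XY mulmxA -XN.
  exact: leq_trans (mxrankM_maxl _ _) (mxrankM_maxr _ _).
have X_free : row_free X by apply/row_freeP; exists Y.
rewrite -!mxrank_ker -(mxrankMfree (kermx M) X_free); apply: mxrankS.
by rewrite sub_kermx -mulmxA XN mulmxA mulmx_ker mul0mx.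
Qed.

(** Transposition exchanges the roles of [M] and [N] and turns a left inverse of [X] into a right
    inverse of its transpose. *)
Lemma rank_nullity_row_full (F : fieldType) (m n : nat)
    (M : 'M[F]_m) (N : 'M[F]_n) (X : 'M[F]_(m, n)) (Y : 'M[F]_(n, m)) :
  X *m N = M *m X -> Y *m X = 1%:M ->
  (\rank N <= \rank M)%N /\ (n - \rank N <= m - \rank M)%N.
Proof.
move=> XN YX; rewrite -(mxrank_tr M) -(mxrank_tr N).
by apply: (@rank_nullity_row_free _ _ _ _ _ X^T Y^T);
  rewrite -!trmx_mul ?XN // YX trmx1.
Qed.

End RankNullity.

Section FunctionMatrix.
Local Open Scope ring_scope.
Variable R : realType.

Definition fun_mx (T U : finType) (f : T -> U) : 'M[R]_(#|T|, #|U|) :=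
  \matrix_(i, j) (f (enum_val i) == enum_val j)%:R.

Lemma fun_mx_comp (T U V : finType) (f : T -> U) (g : U -> V) :
  fun_mx f *m fun_mx g = fun_mx (g \o f).
Proof.
apply/matrixP => i j; rewrite !mxE (bigD1 (enum_rank (f (enum_val i)))) //=.
rewrite !mxE enum_rankK eqxx mul1r big1 ?addr0 // => k ne_k.
rewrite !mxE; case: eqP => [fk|_]; last by rewrite mul0r.
by rewrite fk enum_valK eqxx in ne_k.
Qed.

Lemma fun_mx_cancel (T U : finType) (f : T -> U) (g : U -> T) :
  cancel f g -> fun_mx f *m fun_mx g = 1%:M.
Proof.
move=> fK; rewrite fun_mx_comp; apply/matrixP => i j.
by rewrite !mxE /= fK (inj_eq enum_val_inj).
Qed.

Lemma adjmx_sum (A : finType) (D : dfa A) :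
  adjmx R D = \sum_a fun_mx (fun q => trans D q a).
Proof.
apply/matrixP => i j; rewrite summxE mxE cardsE -sum1_card natr_sum big_mkcond.
by apply: eq_bigr => a _; rewrite mxE -mulrb.
Qed.

Variables (A : finType) (D E : dfa A) (h : state D -> state E).
Hypothesis h_morph : forall q a, h (trans D q a) = trans E (h q) a.

Lemma fun_mx_adjmx : fun_mx h *m adjmx R E = adjmx R D *m fun_mx h.
Proof.
rewrite !adjmx_sum mulmx_sumr mulmx_suml; apply: eq_bigr => a _.
by rewrite !fun_mx_comp; congr fun_mx; apply: funext => q /=.
Qed.

(** The retraction [g] is a plain map of states; its matrix serves as the right inverse of that of
    [h]. *)
Lemma injective_morphism_rank_nullity (g : state E -> state D) :
  cancel h g ->
  (\rank (adjmx R D) <= \rank (adjmx R E))%N /\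
  (nullity (adjmx R D) <= nullity (adjmx R E))%N.
Proof.
move=> hK; rewrite !nullityE.
exact: rank_nullity_row_free fun_mx_adjmx (fun_mx_cancel hK).
Qed.

Lemma surjective_morphism_rank_nullity (g : state E -> state D) :
  cancel g h ->
  (\rank (adjmx R E) <= \rank (adjmx R D))%N /\
  (nullity (adjmx R E) <= nullity (adjmx R D))%N.
Proof.
move=> gK; rewrite !nullityE.
exact: rank_nullity_row_full fun_mx_adjmx (fun_mx_cancel gK).
Qed.

End FunctionMatrix.

Section Automata.
Variable A : finType.
Implicit Types D E : dfa A.

(** The right language of a state, by which states of different automata are matched. *)
Definition state_lang D (q : state D) (w : seq A) : bool :=
  trans_word q w \in final D.

Definition reachable D (q : state D) : Prop :=
  exists w, q = trans_word (init D) w.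

Lemma reachable_init D : `[< reachable (init D) >].
Proof. by apply/asboolP; exists [::]. Qed.

Lemma reachable_trans D (q : state D) a :
  `[< reachable q >] -> `[< reachable (trans D q a) >].
Proof.
move=> /asboolP[w ->]; apply/asboolP; exists (rcons w a).
by rewrite /trans_word foldl_rcons.
Qed.

(** The classical boolean reflection of reachability makes the reachable states a finite type. *)
Definition reach_dfa D : dfa A :=
  @DFA A {q : state D | `[< reachable q >]}
    (fun q a => exist _ (trans D (val q) a) (reachable_trans a (valP q)))
    (exist _ (init D) (reachable_init D)) [set q | val q \in final D].

Lemma reach_dfa_trans_word D (q : state (reach_dfa D)) w :
  val (trans_word q w) = trans_word (val q) w.
Proof. by elim: w q => //= a w IHw q; rewrite IHw. Qed.

Lemma reach_dfa_equiv D : dfa_equiv (reach_dfa D) D.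
Proof. by move=> w; rewrite !inE reach_dfa_trans_word. Qed.

Definition min_size D : Prop :=
  forall E, dfa_equiv E D -> dfa_size D <= dfa_size E.

(** The reachable part recognises the same language, so by minimality it has as many states as
    [D]. *)
Lemma min_size_reachable D (q : state D) : min_size D -> reachable q.
Proof.
move=> /(_ _ (@reach_dfa_equiv D)); rewrite /dfa_size card_sig => le_D.
have /eqP/setP/(_ q) : [set q : state D | `[< reachable q >]] == setT.
  by rewrite eqEcard subsetT cardsT cardsE.
by rewrite !inE => /asboolP.
Qed.

(* After redirecting transitions along [r], states outside the image of [r]
   become unreachable; this reduces merging states to [min_size_reachable]. *)
Definition redirect_dfa D (r : state D -> state D) : dfa A :=
  @DFA A (state D) (fun q a => r (trans D q a)) (r (init D)) (final D).

Lemma redirect_dfa_state_lang D (r : state D -> state D) (q : state D) :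
  (forall p, state_lang (r p) =1 state_lang p) ->
  @state_lang (redirect_dfa r) q =1 state_lang q.
Proof.
move=> r_lang w; elim: w q => //= a w IHw q.
by rewrite -[LHS]/(@state_lang (redirect_dfa r) (r (trans D q a)) w) IHw r_lang.
Qed.

(** If [p] and [q] were distinct, redirecting to [p] the transitions into [q] would keep the
    language and the number of states, so the result would again be minimal; yet no word leads to
    [q] in it. *)
Lemma min_size_reduced D (p q : state D) :
  min_size D -> state_lang p =1 state_lang q -> p = q.
Proof.
move=> minD pq_lang; apply/eqP/negPn/negP => ne_pq.
pose r s := if s == q then p else s.
have r_lang s : state_lang (r s) =1 state_lang s.
  by rewrite /r; case: eqP => [->|].
have r_neq s : r s != q by rewrite /r; case: ifP => [|/negbT].
have equiv_r : dfa_equiv (redirect_dfa r) D.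
  by move=> w; rewrite -[RHS]r_lang -(redirect_dfa_state_lang _ r_lang).
have min_r : min_size (redirect_dfa r).
  by move=> E equiv_E; apply: minD => w; rewrite equiv_E equiv_r.
have [w] := @min_size_reachable (redirect_dfa r) q min_r.
(* A state reached by the empty word or through a last letter is a value of [r], hence not [q]. *)
case/lastP: w => [|w a]; rewrite /trans_word ?foldl_rcons /= => q_eq.
  by have := r_neq (init D); rewrite -q_eq eqxx.
have := r_neq (trans D (trans_word (init (redirect_dfa r)) w) a).
by rewrite -q_eq eqxx.
Qed.

Lemma state_lang_trans D (q : state D) a w :
  state_lang (trans D q a) w = state_lang q (a :: w).
Proof. by []. Qed.

Lemma equiv_state_lang D E v : dfa_equiv D E ->
  state_lang (trans_word (init D) v) =1 state_lang (trans_word (init E) v).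
Proof.
by move=> eqDE w; have := eqDE (v ++ w); rewrite !inE /trans_word !foldl_cat.
Qed.

(** The map [h] sends a reachable state of [E] to the state of [D] with the same right language,
    found by reading the same word; [g] goes back, as every state of [D] is reachable. Equal right
    languages force equal states in [D], so [h] is a morphism and [g] a section of it. *)
Lemma reach_dfa_onto D E : min_size D -> dfa_equiv E D ->
  exists (h : state (reach_dfa E) -> state D) (g : state D -> state (reach_dfa E)),
    (forall q a, h (trans (reach_dfa E) q a) = trans D (h q) a) /\ cancel g h.
Proof.
move=> minD eqED.
have [h h_lang] : {h : state (reach_dfa E) -> state D &
    forall q, state_lang (h q) =1 state_lang (val q)}.
  apply: (@choice _ _ (fun q p => state_lang p =1 state_lang (val q))) => q.
  have /asboolP[v ->] := valP q; exists (trans_word (init D) v) => w.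
  by rewrite (equiv_state_lang v eqED).
have [g g_lang] : {g : state D -> state (reach_dfa E) &
    forall p, state_lang (val (g p)) =1 state_lang p}.
  apply: (@choice _ _ (fun p q => state_lang (val q) =1 state_lang p)) => p.
  have [v ->] := min_size_reachable p minD.
  exists (trans_word (init (reach_dfa E)) v) => w.
  by rewrite reach_dfa_trans_word (equiv_state_lang v eqED).
exists h, g; split=> [q a|p]; apply: min_size_reduced => // w.
  by rewrite h_lang state_lang_trans h_lang.
by rewrite h_lang g_lang.
Qed.

End Automata.

Theorem theorem1 (R : realType) (A : finType) (D : dfa A) :
  (forall E : dfa A, dfa_equiv E D -> dfa_size D <= dfa_size E)
  <->
  (forall E : dfa A, dfa_equiv E D ->
     \rank (adjmx R D) <= \rank (adjmx R E) /\
     nullity (adjmx R D) <= nullity (adjmx R E)).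
Proof.
split=> [minD E eqED|min_rn E /min_rn[le_rank]].
  have [h [g [h_morph gK]]] := reach_dfa_onto minD eqED.
  have [rk_D null_D] := surjective_morphism_rank_nullity R h_morph gK.
  (* The inclusion [val] of the reachable part is retracted by sending every unreachable state to
     the initial one. *)
  have [|rk_E null_E] := @injective_morphism_rank_nullity R _ (reach_dfa E) E val
      (fun _ _ => erefl) (insubd (init (reach_dfa E))).
    exact: valKd.
  by split; [exact: leq_trans rk_D rk_E | exact: leq_trans null_D null_E].
rewrite !nullityE => le_null.
rewrite -(subnKC (rank_leq_row (adjmx R D))).
by rewrite -(subnKC (rank_leq_row (adjmx R E))) leq_add.
Qed.
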